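(* Let $A$ be a two-dimensional algebra over $\mathbb F_2$ with structure matrix $\begin{pmatrix}a_1&b_1\\ a_2&b_2\\ a_3&b_3\\ a_4&b_4\end{pmatrix}$ with respect to a linear base $\{e,f\}$. Then $A$ is endo-commutative if and only if the scalars $a_1,b_1,a_2,b_2,a_3,b_3,a_4,b_4\in\mathbb F_2$ satisfy all eight of the following equations: $$\begin{aligned} &a_1a_2+a_2b_1b_2+a_1a_3b_2+a_2a_4b_1+a_1a_3+a_2b_3+a_3b_3+a_3a_4b_3=0,\\ &a_1a_2+a_2b_1b_2+a_2a_3b_1+a_1a_4b_2+a_1a_4+a_2b_4+a_3a_4b_4+a_4b_4=0,\\ &a_1a_3+a_1a_4+a_4b_1+a_2b_1b_3+a_2b_1b_4+a_1a_3b_4+a_3b_1+a_1a_4b_3=0,\\ &a_1a_2a_4+a_2a_4b_4+a_2b_2b_4+a_1a_2a_3+a_2b_2b_3+a_2a_3b_3=0,\\ &a_1a_2b_1+b_1b_2+a_1b_2b_3+a_2b_1b_4+a_3b_1+b_2b_3+a_3b_3+a_3b_3b_4=0,\\ &a_1a_2b_1+b_1b_2+a_2b_1b_3+a_1b_2b_4+a_4b_1+b_2b_4+a_4b_3b_4+a_4b_4=0,\\ &a_1a_3b_1+a_1a_4b_1+a_4b_1b_4+b_1b_2b_3+b_1b_2b_4+a_3b_1b_3=0,\\ &a_2a_3b_1+a_2a_4b_1+a_4b_2b_3+b_2b_3+b_2b_4+a_2b_4+a_2b_3+a_3b_2b_4=0. \end{aligned}$$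
   Context: An algebra over the two-element field $\mathbb F_2$ is an $\mathbb F_2$-vector space with a bilinear multiplication, not assumed associative, commutative or unital. The structure matrix with respect to a linear base $\{e,f\}$ records $e^2=a_1e+b_1f$, $f^2=a_2e+b_2f$, $ef=a_3e+b_3f$, $fe=a_4e+b_4f$. An algebra $A$ is endo-commutative if $x^2y^2=(xy)^2$ for all $x,y\in A$. *)

(* Defs.v *)
From HB Require Import structures.
From mathcomp Require Import all_boot all_order all_algebra.

Set Implicit Arguments.
Unset Strict Implicit.
Unset Printing Implicit Defensive.

Import GRing.Theory.
Local Open Scope ring_scope.

(* An algebra over K, not assumed associative, commutative or unital, is a   *)
(* K-vector space A with a multiplication mul : {bilinear A -> A -> A};      *)
(* MathComp's algType is not suitable, being associative and unital.         *)

Definition endo_commutative (K : fieldType) (A : vectType K)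
    (mul : {bilinear A -> A -> A}) : Prop :=
  forall x y : A, mul (mul x x) (mul y y) = mul (mul x y) (mul x y).

(* The rows are, in this order, the coordinates of e^2, f^2, ef and fe; the  *)
(* numerals are elements of 'I_4 (rows) and 'I_2 (columns), counted from 0.  *)
Definition is_structure_matrix (K : fieldType) (A : vectType K)
    (mul : {bilinear A -> A -> A}) (e f : A) (M : 'M[K]_(4, 2)) : Prop :=
  [/\ mul e e = M 0 0 *: e + M 0 1 *: f,
      mul f f = M 1 0 *: e + M 1 1 *: f,
      mul e f = M 2 0 *: e + M 2 1 *: f
    & mul f e = M 3 0 *: e + M 3 1 *: f].

(* Main.v *)
Require Import Defs.
From HB Require Import structures.
From mathcomp Require Import all_boot all_order all_algebra.

Import GRing.Theory.
Local Open Scope ring_scope.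

(** Over F_2 a plane with base {e, f} has the four vectors 0, e, f and e + f,
    and the identity x^2 y^2 = (xy)^2 is trivial when x = 0, y = 0 or x = y.
    Only the six ordered pairs of distinct vectors among e, f, e + f remain.

    Write D(x, y) = x^2 y^2 - (xy)^2.  Expanding by bilinearity, most
    terms cancel and there remains, over any field,
      D(x, x + y) = D(x, y) + (x^2(yx) - (xy)x^2),
      D(x + y, x) = D(y, x) - (x^2(yx) - (xy)x^2).
    So, once D(e, f) = D(f, e) = 0, the four pairs involving e + f amount to
    just two conditions, and the algebra is endo-commutative if and only if
      e^2 f^2 = (ef)^2,      f^2 e^2 = (fe)^2,
      e^2 (fe) = (ef) e^2,   f^2 (ef) = (fe) f^2
    (lemma [endo_commutative_on_basis]); the last two are the vanishing of the
    twists x^2(yx) - (xy)x^2 for (x, y) = (e, f) and (f, e).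

    Comparing coordinates in {e, f} turns these four vector equations into
    eight scalar ones.  They are the eight equations of the theorem, after
    squares are simplified by a^2 = a and signs are dropped, 2 being 0: the
    first vector equation gives the first and fifth, the second gives the
    second and sixth, the third gives the third and seventh, and the fourth
    gives the fourth and eighth. *)

Definition endo_defect {K : fieldType} {A : vectType K} (mul : {bilinear A -> A -> A})
    (x y : A) : A :=
  mul (mul x x) (mul y y) - mul (mul x y) (mul x y).

Definition twist {K : fieldType} {A : vectType K} (mul : {bilinear A -> A -> A})
    (x y : A) : A :=
  mul (mul x x) (mul y x) - mul (mul x y) (mul x x).

(** In the expansion the terms x^2 x^2 and x^2 (xy) occur in both x^2 (x+y)^2
    and (x (x+y))^2 and cancel; x^2 y^2 and (xy)^2 make up the defect of (x, y),
    and one term of each side is left over for the twist. *)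
Lemma endo_defect_addr {K : fieldType} {A : vectType K} (mul : {bilinear A -> A -> A})
    (x y : A) :
  endo_defect mul x (x + y) = endo_defect mul x y + twist mul x y.
Proof.
rewrite /endo_defect /twist !(linearDl, linearDr) /=.
by rewrite opprD addrACA subrr add0r opprD addrACA addrC.
Qed.

(** The same twist as in [endo_defect_addr] appears, with the opposite sign:
    hence the pairs (x, x + y) and (x + y, x) impose a single condition. *)
Lemma endo_defect_addl {K : fieldType} {A : vectType K} (mul : {bilinear A -> A -> A})
    (x y : A) :
  endo_defect mul (x + y) x = endo_defect mul y x - twist mul x y.
Proof.
rewrite /endo_defect /twist !(linearDl, linearDr) /=.
rewrite addrACA [X in _ - X]addrACA opprD [LHS]addrACA subrr add0r.
by rewrite opprB addrACA -opprD [X in X - _]addrC [X in _ - X]addrC.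
Qed.

Lemma comb2_inj {K : fieldType} {A : vectType K} {e f : A}
    (x y x' y' : K) :
    free [:: e; f] ->
  x *: e + y *: f = x' *: e + y' *: f <-> x = x' /\ y = y'.
Proof.
rewrite free_cons seq1_free span_seq1 => /andP[e_notin f_neq0].
split=> [|[-> ->] //] /eqP; rewrite -subr_eq0 opprD addrACA -!scalerBl => eq0.
have xx' : x - x' = 0.
  apply: contraNeq e_notin => dx; apply/vlineP; exists (- ((x - x')^-1 * (y - y'))).
  move: eq0; rewrite addr_eq0 => /eqP eqe.
  by rewrite -mulrN -scalerA scaleNr -eqe scalerK.
move: eq0; rewrite xx' scale0r add0r scaler_eq0 (negPf f_neq0) orbF => /eqP yy'.
by split; apply: subr0_eq.
Qed.

Lemma mul_comb2 {K : fieldType} {A : vectType K} {e f : A}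
    {mul : {bilinear A -> A -> A}} {M : 'M[K]_(4, 2)} :
    is_structure_matrix mul e f M -> forall x y x' y' : K,
  mul (x *: e + y *: f) (x' *: e + y' *: f)
    = (x * x' * M 0 0 + x * y' * M 2 0 + y * x' * M 3 0 + y * y' * M 1 0) *: e
    + (x * x' * M 0 1 + x * y' * M 2 1 + y * x' * M 3 1 + y * y' * M 1 1) *: f.
Proof.
case=> ee ff ef fe x y x' y'.
rewrite !(linearDl, linearDr) /= !linearZlr /= ee ff ef fe.
rewrite !(scalerDr, scalerA) [X in X + _ = _]addrACA.
by rewrite [X in _ + X = _]addrACA [LHS]addrACA -!scalerDl !addrA.
Qed.

(** Stated as an induction principle so that a statement about several scalars
    can be split into its values at all points. *)
Lemma F2_ind (P : 'F_2 -> Prop) : P 0 -> P 1 -> forall x, P x.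
Proof.
move=> P0 P1 [[|[|//]] ltx].
  by have -> : Ordinal ltx = 0 by apply: val_inj.
by have -> : Ordinal ltx = 1 by apply: val_inj.
Qed.

Lemma F2_plane_cases {A : vectType 'F_2} {e f : A} :
    basis_of (fullv : {vspace A}) [:: e; f] ->
  forall x : A, [\/ x = 0, x = e, x = f | x = e + f].
Proof.
move=> basis_ef x; have: x \in <<[:: e; f]>>%VS by rewrite (span_basis basis_ef) memvf.
rewrite span_cons span_seq1 => /memv_addP[_ /vlineP[a ->] [_ /vlineP[b ->] ->]].
elim/F2_ind: a; elim/F2_ind: b;
  rewrite !(scale0r, scale1r, add0r, addr0).
- exact: Or41.
- exact: Or43.
- exact: Or42.
- exact: Or44.
Qed.

(** The pairs (e, f) and (f, e) give the first two equations; given these, the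
    pairs (e, e + f) and (e + f, e) both say that the twist of (e, f) is zero,
    and (f, e + f) and (e + f, f) that the twist of (f, e) is zero. *)
Lemma endo_commutative_on_basis {A : vectType 'F_2}
    (mul : {bilinear A -> A -> A}) {e f : A} :
    basis_of (fullv : {vspace A}) [:: e; f] ->
  endo_commutative mul <->
    [/\ mul (mul e e) (mul f f) = mul (mul e f) (mul e f),
        mul (mul f f) (mul e e) = mul (mul f e) (mul f e),
        mul (mul e e) (mul f e) = mul (mul e f) (mul e e)
      & mul (mul f f) (mul e f) = mul (mul f e) (mul f f)].
Proof.
move=> basis_ef; split=> [ec | [ef fe twist_ef twist_fe] x y].
  have defect0 x y : endo_defect mul x y = 0 by apply/eqP; rewrite subr_eq0 ec.
  have twist0 x y : twist mul x y = 0.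
    by have := endo_defect_addr mul x y; rewrite !defect0 add0r.
  by split; [exact: ec | exact: ec | exact: subr0_eq (twist0 _ _)..].
suffices: endo_defect mul x y = 0 by apply: subr0_eq.
have defect_xx z : endo_defect mul z z = 0 by apply: subrr.
have defect_0l z : endo_defect mul 0 z = 0.
  by rewrite /endo_defect !linear0l subrr.
have defect_0r z : endo_defect mul z 0 = 0.
  by rewrite /endo_defect !linear0r subrr.
have defect_ef : endo_defect mul e f = 0 by rewrite /endo_defect ef subrr.
have defect_fe : endo_defect mul f e = 0 by rewrite /endo_defect fe subrr.
have twist_ef0 : twist mul e f = 0 by rewrite /twist twist_ef subrr.
have twist_fe0 : twist mul f e = 0 by rewrite /twist twist_fe subrr.
case: (F2_plane_cases basis_ef x) => ->;
  case: (F2_plane_cases basis_ef y) => -> //.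
- by rewrite endo_defect_addr defect_ef twist_ef0 addr0.
- by rewrite addrC endo_defect_addr defect_fe twist_fe0 addr0.
- by rewrite endo_defect_addl defect_fe twist_ef0 subr0.
- by rewrite addrC endo_defect_addl defect_ef twist_fe0 subr0.
Qed.

Theorem proposition2 (A : vectType 'F_2) (dimA : \dim (fullv : {vspace A}) = 2%N)
    (mul : {bilinear A -> A -> A}) (e f : A)
    (basis_ef : basis_of (fullv : {vspace A}) [:: e; f])
    (M : 'M['F_2]_(4, 2)) (structM : is_structure_matrix mul e f M) :
  let a1 := M 0 0 in let b1 := M 0 1 in
  let a2 := M 1 0 in let b2 := M 1 1 in
  let a3 := M 2 0 in let b3 := M 2 1 in
  let a4 := M 3 0 in let b4 := M 3 1 in
  endo_commutative mul <->
    (a1 * a2 + a2 * b1 * b2 + a1 * a3 * b2 + a2 * a4 * b1 + a1 * a3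
       + a2 * b3 + a3 * b3 + a3 * a4 * b3 = 0
  /\ a1 * a2 + a2 * b1 * b2 + a2 * a3 * b1 + a1 * a4 * b2 + a1 * a4
       + a2 * b4 + a3 * a4 * b4 + a4 * b4 = 0
  /\ a1 * a3 + a1 * a4 + a4 * b1 + a2 * b1 * b3 + a2 * b1 * b4
       + a1 * a3 * b4 + a3 * b1 + a1 * a4 * b3 = 0
  /\ a1 * a2 * a4 + a2 * a4 * b4 + a2 * b2 * b4 + a1 * a2 * a3
       + a2 * b2 * b3 + a2 * a3 * b3 = 0
  /\ a1 * a2 * b1 + b1 * b2 + a1 * b2 * b3 + a2 * b1 * b4 + a3 * b1
       + b2 * b3 + a3 * b3 + a3 * b3 * b4 = 0
  /\ a1 * a2 * b1 + b1 * b2 + a2 * b1 * b3 + a1 * b2 * b4 + a4 * b1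
       + b2 * b4 + a4 * b3 * b4 + a4 * b4 = 0
  /\ a1 * a3 * b1 + a1 * a4 * b1 + a4 * b1 * b4 + b1 * b2 * b3
       + b1 * b2 * b4 + a3 * b1 * b3 = 0
  /\ a2 * a3 * b1 + a2 * a4 * b1 + a4 * b2 * b3 + b2 * b3 + b2 * b4
       + a2 * b4 + a2 * b3 + a3 * b2 * b4 = 0).
Proof.
move=> a1 b1 a2 b2 a3 b3 a4 b4.
have free_ef := basis_free basis_ef; have [ee ff ef fe] := structM.
(* The list of scalar equations has the four coordinates on e before the four
   coordinates on f, so the pairs of coordinates have to be interleaved. *)
have regroup (E1 E2 E3 E4 P1 P2 P3 P4 Q1 Q2 Q3 Q4 : Prop) :
    (E1 <-> P1 /\ Q1) -> (E2 <-> P2 /\ Q2) ->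
    (E3 <-> P3 /\ Q3) -> (E4 <-> P4 /\ Q4) ->
  [/\ E1, E2, E3 & E4] <->
  (P1 /\ P2 /\ P3 /\ P4 /\ Q1 /\ Q2 /\ Q3 /\ Q4).
  by move=> E1P E2P E3P E4P; split=> [[]|?]; first tauto; split; tauto.
have comb2_eqP (x y x' y' p q : 'F_2) : x - x' = p -> y - y' = q ->
    x *: e + y *: f = x' *: e + y' *: f <-> p = 0 /\ q = 0.
  move=> <- <-; apply: (iff_trans (comb2_inj _ _ _ _ free_ef)).
  by split=> [[-> ->]|[/subr0_eq -> /subr0_eq ->] //]; rewrite !subrr.
apply: (iff_trans (endo_commutative_on_basis _ basis_ef)).
rewrite ee ff ef fe !(mul_comb2 structM).
rewrite -/a1 -/b1 -/a2 -/b2 -/a3 -/b3 -/a4 -/b4.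
apply: regroup; apply: comb2_eqP.
(* In each goal the two polynomials differ by multiples of 2 and of the
   a^2 - a only, so they agree as functions; all 2^8 points are evaluated. *)
all: move: {ee ff ef fe structM} a1 b1 a2 b2 a3 b3 a4 b4.
all: by do 8![elim/F2_ind]; apply/eqP.
Qed.
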